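(* Let $n\geq1$, $m\geq1$, let $g^1,\dots,g^m$ be $\mathcal{C}^\infty$-smooth functions of $(x^1,\dots,x^n)\in\mathbb{K}^n$ with values in $\mathbb{K}$, let $f=f(y^1,\dots,y^m)$ be a $\mathcal{C}^\infty$-smooth function from $\mathbb{K}^m$ to $\mathbb{K}$, and let $$h(x^1,\dots,x^n):=f\big(g^1(x^1,\dots,x^n),\dots,g^m(x^1,\dots,x^n)\big).$$ For every integer $\kappa\geq1$ and every choice of indices $i_1,\dots,i_\kappa\in\{1,\dots,n\}$, the partial derivative of $h$ with respect to $x^{i_1},\dots,x^{i_\kappa}$ is given by the following explicit polynomial with integer coefficients in the partial derivatives of $f$ (evaluated at $y=(g^1(x),\dots,g^m(x))$) and the partial derivatives of the $g^j$: $$ \begin{aligned} \frac{\partial^\kappa h}{\partial x^{i_1}\cdots\partial x^{i_\kappa}} &=\sum_{d=1}^\kappa\ \sum_{1\leq\lambda_1<\cdots<\lambda_d\leq\kappa}\ \sum_{\substack{\mu_1\geq1,\dots,\mu_d\geq1\\ \mu_1\lambda_1+\cdots+\mu_d\lambda_d=\kappa}}\ \sum_{l_{1:1},\dots,l_{1:\mu_1}=1}^m\cdots\sum_{l_{d:1},\dots,l_{d:\mu_d}=1}^m\\ &\frac{\partial^{\mu_1+\cdots+\mu_d}f}{\partial y^{l_{1:1}}\cdots\partial y^{l_{1:\mu_1}}\cdots\partial y^{l_{d:1}}\cdots\partial y^{l_{d:\mu_d}}}\\ &\Bigg[\sum_{\sigma\in\mathfrak{F}_\kappa^{(\mu_1,\lambda_1),\dots,(\mu_d,\lambda_d)}}\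 \prod_{1\leq\nu_1\leq\mu_1}\frac{\partial^{\lambda_1}g^{l_{1:\nu_1}}}{\partial x^{i_{\sigma(1:\nu_1:1)}}\cdots\partial x^{i_{\sigma(1:\nu_1:\lambda_1)}}}\ \cdots \prod_{1\leq\nu_d\leq\mu_d}\frac{\partial^{\lambda_d}g^{l_{d:\nu_d}}}{\partial x^{i_{\sigma(d:\nu_d:1)}}\cdots\partial x^{i_{\sigma(d:\nu_d:\lambda_d)}}}\Bigg]. \end{aligned} $$
   Context: $\mathbb{K}=\mathbb{R}$ or $\mathbb{C}$. The $l_{e:\nu}$ ($1\leq e\leq d$, $1\leq\nu\leq\mu_e$) are independent summation indices with values in $\{1,\dots,m\}$. Given integers $1\le\lambda_1<\cdots<\lambda_d$ and $\mu_1,\dots,\mu_d\geq1$ with $\sum_e\mu_e\lambda_e=\kappa$, identify $\{1,\dots,\kappa\}$ with the set of triples $e\!:\!\nu\!:\!\gamma$ ($1\leq e\leq d$, $1\leq\nu\leq\mu_e$, $1\leq\gamma\leq\lambda_e$) listed in lexicographic order $1\!:\!1\!:\!1,\dots,1\!:\!1\!:\!\lambda_1,\dots,1\!:\!\mu_1\!:\!\lambda_1,\dots,d\!:\!1\!:\!1,\dots,d\!:\!\mu_d\!:\!\lambda_d$. Let $\mathfrak{S}_\kappa$ be the permutation group of $\{1,\dots,\kappa\}$ and let $\mathfrak{H}_\kappa^{(\mu_1,\lambda_1),\dots,(\mu_d,\lambda_d)}$ be the subgroup of those permutations which, for each $e$, permute among themselves the $\mu_e$ blocks $\{e\!:\!\nu\!:\!1,\dots,e\!:\!\nu\!:\!\lambda_e\}$,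 $1\leq\nu\leq\mu_e$ (so arbitrary permutations inside each block, composed with arbitrary permutations of the $\mu_e$ blocks); its cardinality is $\mu_1!(\lambda_1!)^{\mu_1}\cdots\mu_d!(\lambda_d!)^{\mu_d}$. Then $\mathfrak{F}_\kappa^{(\mu_1,\lambda_1),\dots,(\mu_d,\lambda_d)}:=\mathfrak{S}_\kappa/\mathfrak{H}_\kappa^{(\mu_1,\lambda_1),\dots,(\mu_d,\lambda_d)}$, and a sum over $\sigma\in\mathfrak{F}_\kappa^{\dots}$ means a sum over a complete set of representatives $\sigma$ of the cosets $\sigma\mathfrak{H}=\{\sigma\circ h:h\in\mathfrak{H}\}$, chosen arbitrarily once and for all (independently of the values of the indices $l_{e:\nu}$). *)

(* Defs.v *)
From mathcomp Require Import all_boot all_order all_algebra all_fingroup.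
From mathcomp Require Import all_classical all_reals all_analysis.
From mathcomp Require Import complex.

Set Implicit Arguments.
Unset Strict Implicit.
Unset Printing Implicit Defensive.

Import Order.TTheory GRing.Theory Num.Theory.
Import numFieldNormedType.Exports.

Local Open Scope ring_scope.

Section Smoothness.
Context {K : numFieldType} {n : nat}.
Implicit Types (f : 'rV[K]_n -> K) (s : seq 'I_n).

(* [f] is of class C^(k+1) iff it is (K-)differentiable everywhere and its
   differential, as a map from K^n to the finite-dimensional space of linear
   forms on K^n, is of class C^k; the latter is expressed by evaluating the
   differential at every vector [v]. *)
Fixpoint of_class (k : nat) f : Prop :=
  if k is k'.+1 then
    (forall x, differentiable f x) /\
    (forall v, of_class k' (fun x => 'd f x v))
  else continuous f.

Definition smooth f : Prop := forall k, of_class k f.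

Definition partial (i : 'I_n) f : 'rV[K]_n -> K :=
  fun x => 'D_(delta_mx 0 i) f x.

(* For [s = [:: i_1; ...; i_k]], [partials s f] is
   d^k f / dx^{i_1} ... dx^{i_k} = d/dx^{i_1} (... (d f/dx^{i_k}) ...). *)
Definition partials s f : 'rV[K]_n -> K := foldr partial f s.

(* ['D_v f x] has a default value when the limit does not exist;
   [has_partials s f] says that every partial derivative taken along the way
   in [partials s f] does exist, at every point. *)
Fixpoint has_partials s f : Prop :=
  if s is i :: s' then
    has_partials s' f /\
    (forall x, derivable (partials s' f) x (delta_mx 0 i))
  else True.

End Smoothness.

Section BlockPermutations.
(* Here [{1, ..., kappa}] is ['I_k.+1] (so [kappa = k.+1 >= 1]); all indices,
   in particular those of the triples e:nu:gamma, are shifted to start at 0. *)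
Context {k d : nat}.
Implicit Types (lam mu : {ffun 'I_d -> 'I_k.+2}).

Definition lam_ok lam : bool :=
  [forall e, 0 < lam e]%N &&
  [forall e : 'I_d, forall e' : 'I_d, (e < e')%N ==> (lam e < lam e')%N].

Definition mu_ok lam mu : bool :=
  [forall e, 0 < mu e]%N && (\sum_(e < d) mu e * lam e == k.+1)%N.

(* Rank of the triple e:nu:gamma in the lexicographic order; when
   [lam_ok lam] and [mu_ok lam mu] hold it is smaller than [k.+1], so that
   [inord] is not used outside of its proper domain. *)
Definition triple lam mu (e : 'I_d) (nu : 'I_(mu e)) (gamma : 'I_(lam e)) :
    'I_k.+1 :=
  inord (\sum_(e' < d | (e' < e)%N) mu e' * lam e' + nu * lam e + gamma)%N.

Definition block lam mu (e : 'I_d) (nu : 'I_(mu e)) : {set 'I_k.+1} :=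
  [set triple nu gamma | gamma : 'I_(lam e)].

Definition block_perms lam mu : {set 'S_k.+1} :=
  [set h : 'S_k.+1 | [forall e : 'I_d, forall nu : 'I_(mu e),
    exists nu' : 'I_(mu e), h @: block lam nu == block lam nu']].

Lemma block_perms_group lam mu : group_set (block_perms lam mu).
Proof.
apply/group_setP; split=> [|s t].
  rewrite inE; apply/forallP => e; apply/forallP => nu; apply/existsP.
  by exists nu; rewrite imset_perm1.
rewrite !inE => /forallP Hs /forallP Ht.
apply/forallP => e; apply/forallP => nu; apply/existsP.
have /existsP[nu1 /eqP E1] := forallP (Hs e) nu.
have /existsP[nu2 /eqP E2] := forallP (Ht e) nu1.
exists nu2; rewrite -E2 -E1 -imset_comp; apply/eqP/eq_imset => x.
by rewrite /= permM.
Qed.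

(* Since [(s * t) x = t (s x)] for permutations, the coset
   { s o h | h in H } of the mathematical notation is [H :* s]. *)
Definition is_coset_repr lam mu (F : {set 'S_k.+1}) : bool :=
  is_transversal F (rcosets (block_perms lam mu) [set: 'S_k.+1])
    [set: 'S_k.+1].

End BlockPermutations.

(* Main.v *)
(* By induction on the list of indices, a partial derivative of h is a sum over
   all set partitions P of the positions of these indices: the block B of P
   contributes the vector of the derivatives of the g^j with respect to the
   indices in B, and the |P|-th differential of f is evaluated at these vectors.
   Differentiating once more either inserts the new position in a block of P
   (if the derivative hits that block's vector) or adds a singleton block (if it
   hits f).

   The standard blocks of type (lambda, mu) are moved by a permutation s to a
   set partition, which determines and is determined by the coset of s; so the
   sum over coset representatives is the sum over the partitions with mu_e
   blocks of size lambda_e, and every partition has exactly one such type.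

   Orders of differentiation are irrelevant by Schwarz's theorem, which is
   deduced over both fields from a mean value inequality along the real
   segment [0, 1]. *)
Require Import Defs.
From mathcomp Require Import all_boot all_order all_algebra all_fingroup.
From mathcomp Require Import all_classical all_reals all_analysis.
From mathcomp Require Import complex ring.

Set Implicit Arguments.
Unset Strict Implicit.
Unset Printing Implicit Defensive.

Import Order.TTheory GRing.Theory Num.Theory.
Import numFieldNormedType.Exports.

Local Open Scope ring_scope.

(** * Mean value inequality over the real and the complex numbers *)

(* For [K = R[i]], [0 <= t <= 1] forces [t] to be real; the factor 2 accounts
   for the separate bounds on the real and imaginary parts. *)
Definition mean_value_bound (K : numFieldType) :=
  forall (phi dphi : K -> K) (c e : K),
    (forall t : K, is_derive t (1 : K) phi (dphi t)) ->
    (forall t, 0 <= t <= 1 -> `|dphi t - c| <= e) ->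
    `|phi 1 - phi 0 - c| <= e *+ 2.

Lemma mean_value_bound_real (R : realType) : mean_value_bound R.
Proof.
move=> phi dphi c e hd he.
have hc : {within `[0, 1], continuous phi}%classic.
  by apply: derivable_within_continuous => x _; have [] := hd x.
have [t] := MVT ltr01 (fun x _ => hd x) hc.
rewrite in_itv /= => /andP[t0 t1] ->.
rewrite subr0 mulr1 (le_trans (he t _)) ?(ltW t0) ?(ltW t1) //.
have e0 : 0 <= e by apply: le_trans (he 0 _); rewrite ?lexx ?ler01.
by rewrite mulr2n lerDl.
Qed.

Lemma normc_real (R : rcfType) (t : R) : `|t%:C%C| = `|t|%:C%C.
Proof. by rewrite normc_def /= expr0n addr0 sqrtr_sqr. Qed.

Lemma Re_le_normc (R : rcfType) (z : R[i]%C) (e : R) :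
  `|z| <= e%:C%C -> `|complex.Re z| <= e.
Proof.
rewrite normc_def lecR; apply: le_trans.
by rewrite -sqrtr_sqr ler_wsqrtr // lerDl sqr_ge0.
Qed.

(** Along real increments the real part of the complex difference quotient is the difference
    quotient of the real part, and [|Re z| <= |z|] transfers the limit. *)
Lemma is_derive_Re (R : realType) (C := R[i]%C : numFieldType) (phi : C -> C)
    (t : R) (d : C) :
  is_derive ((t%:C)%C : C) (1 : C) phi d ->
  is_derive t (1 : R) (fun s : R => complex.Re (phi (s%:C)%C)) (complex.Re d).
Proof.
move=> [hd hv].
have H : ((fun h : R => h^-1 *: (complex.Re (phi ((h *: 1 + t)%:C)%C)
      - complex.Re (phi (t%:C)%C))) @ 0^' --> complex.Re d)%classic.
  apply/cvgrPdist_le => e e0.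
  have := hd; rewrite /derivable => /cvgrPdist_le.
  have -> : lim ((fun h : C => h^-1 *: ((phi \o shift ((t%:C)%C : C)) (h *: 1)
      - phi (t%:C)%C)) @ 0^')%classic = d by exact: hv.
  move=> /(_ (e%:C)%C); rewrite ltcR => /(_ e0).
  rewrite !near_withinE => /nbhs_ballP[r /= r0 hr].
  (* A positive complex number is real, so the radius of the complex ball is also a real radius. *)
  have rr : r = (complex.Re r)%:C%C.
    by move: r0; rewrite ltcE; case: (r) => a b /= /andP[/eqP ->].
  apply/nbhs_ballP; exists (complex.Re r).
    by move: r0; rewrite {1}rr ltcR.
  move=> h hh h0; rewrite /shift /=.
  have := hr (h%:C)%C; rewrite /ball /= !sub0r !normrN.
  move: hh; rewrite /ball /= sub0r normrN => hh.
  rewrite normc_real rr ltcR => /(_ hh).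
  have hc0 : (h%:C)%C != 0 :> R[i]%C by apply: contraNneq h0 => -[->].
  move=> /(_ hc0) /Re_le_normc; congr (_ <= _); congr `|_|.
  rewrite /shift /= !scaler1.
  rewrite -fmorphV -[X in phi (_ + X)]/((t%:C)%C) -rmorphD /=.
  move: (phi _) (phi _) => z w.
  case: d {hd hv hr} => a b; case: z => a1 b1; case: w => a2 b2.
  by rewrite /= mul0r subr0.
split; first by apply/cvg_ex; exists (complex.Re d).
exact: cvg_lim H.
Qed.

(** The mean value theorem fails for complex-valued functions; it is applied to the real and the
    imaginary part on the real segment, and the two errors, each at most [e], add up. *)
Lemma mean_value_bound_complex (R : realType) :
  mean_value_bound (R[i]%C : numFieldType).
Proof.
have key (phi dphi : (R[i]%C : numFieldType) -> (R[i]%C : numFieldType)) c e :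
    (forall t : (R[i]%C : numFieldType),
       is_derive t (1 : (R[i]%C : numFieldType)) phi (dphi t)) ->
    (forall t, 0 <= t <= 1 -> `|dphi t - c| <= e) ->
    (`|complex.Re (phi 1 - phi 0 - c)|%:C)%C <= e.
  move=> hd he.
  have hdR (s : R) := is_derive_Re (hd (s%:C)%C).
  have hc : {within `[0, 1], continuous (fun s : R => complex.Re (phi (s%:C)%C))}%classic.
    by apply: derivable_within_continuous => x _; have [] := hdR x.
  have [t] := MVT ltr01 (fun x _ => hdR x) hc.
  rewrite in_itv /= subr0 mulr1 => /andP[t0 t1] E.
  have := he (t%:C)%C; rewrite !lecR (ltW t0) (ltW t1) => /(_ isT).
  apply: le_trans.
  have -> : complex.Re (phi 1 - phi 0 - c) = complex.Re (dphi (t%:C)%C - c).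
    by rewrite !raddfB /= -E.
  exact: normc_ge_Re.
move=> phi dphi c e hd he.
set z := _ - c.
rewrite [z]complexE (le_trans (ler_normD _ _)) // mulr2n lerD //.
  by rewrite normc_real; apply: key hd he.
(* [Im z = Re (- i z)], so the imaginary part is [key] for [- i phi]. *)
have nI : `|'i%C| = 1 :> R[i]%C by rewrite normc_def /= expr0n expr1n add0r sqrtr1.
rewrite normrM nI mul1r normc_real.
have -> : complex.Im z = complex.Re (- 'i%C * phi 1 - - 'i%C * phi 0 - - 'i%C * c).
  rewrite -!mulrBr -/z.
  by case: (z) => a b /=; rewrite mulN1r opprK oppr0 mul0r add0r.
apply: (key (fun x => - 'i%C * phi x) (fun x => - 'i%C * dphi x)) => t.
by move=> /he; rewrite -mulrBr normrM normrN nI mul1r.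
Qed.

(** * Symmetry of the second differential *)

Lemma is_derive_line (K : numFieldType) (V : normedModType K) (F : V -> K)
    (a w : V) (s : K) :
  differentiable F (a + s *: w) ->
  is_derive s (1 : K) (fun r : K => F (a + r *: w)) ('d F (a + s *: w) w).
Proof.
move=> hF.
have E : (fun h : K => h^-1 *: (((fun r : K => F (a + r *: w)) \o shift s) (h *: 1)
            - F (a + s *: w)))
       = (fun h : K => h^-1 *: ((F \o shift (a + s *: w)) (h *: w) - F (a + s *: w))).
  apply/funext => h /=; congr (_ *: (F _ - _)).
  by rewrite [h *: 1]mulr1 scalerDl addrCA.
split; first by rewrite /derivable E; exact: diff_derivable.
by rewrite /derive E -/(derive F (a + s *: w) w) deriveE.
Qed.

(** The mean value inequality is used twice, along [u] for [Fv] and then along [v] for an increment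
    of [F]; each use costs a factor 2, whence the 4. *)
Lemma second_difference_bound (K : numFieldType) (V : normedModType K)
    (F : V -> K) (u v x : V) (e : K) :
  mean_value_bound K ->
  (forall y, differentiable F y) ->
  (forall y, differentiable (fun z => 'd F z v) y) ->
  {for x, continuous (fun y => 'd (fun z => 'd F z v) y u)} ->
  0 < e ->
  exists2 r, 0 < r & forall t, 0 < t < r ->
    `|F (x + t *: u + t *: v) - F (x + t *: v) - (F (x + t *: u) - F x)
      - t ^+ 2 * 'd (fun z => 'd F z v) x u| <= e * t ^+ 2 *+ 4.
Proof.
move=> mvb dF dFv cW e0; set Fv := fun z => 'd F z v.
set W := fun y => 'd Fv y u; rewrite -/(W x).
have /cvgrPdist_le /(_ e e0) /nbhs_ballP[d /= d0 hd] := cW.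
have n0 : 0 < `|u| + `|v| + 1 by rewrite ltr_wpDl ?addr_ge0.
(* The points used below are within [t * (|u| + |v|)] of [x]; adding 1 keeps the divisor positive
   even when [u = v = 0]. *)
exists (d / (`|u| + `|v| + 1)) => [|t /andP[t0]]; first exact: divr_gt0.
rewrite ltr_pdivlMr // => td.
have nearx a b : 0 <= a <= 1 -> 0 <= b <= 1 ->
    `|W (x + a *: (t *: v) + b *: (t *: u)) - W x| <= e.
  move=> /andP[a0 a1] /andP[b0 b1]; rewrite distrC; apply: hd.
  rewrite -ball_normE /ball_ /= opprD addrA opprD addrA subrr add0r -opprD normrN.
  rewrite (le_lt_trans _ td) // (le_trans (ler_normD _ _)) // !normrZ.
  rewrite (ger0_norm a0) (ger0_norm b0) (gtr0_norm t0) !mulrDr mulr1.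
  rewrite [X in _ <= X + _]addrC -addrA lerD //.
    by rewrite ler_piMl // mulr_ge0 // ltW.
  by rewrite (le_trans (ler_piMl _ _)) // ?lerDl ?mulr_ge0 // ltW.
have step1 a : 0 <= a <= 1 ->
    `|Fv (x + a *: (t *: v) + t *: u) - Fv (x + a *: (t *: v)) - t * W x|
      <= e * t *+ 2.
  move=> ha.
  have := mvb (fun b : K => Fv (x + a *: (t *: v) + b *: (t *: u)))
     (fun b : K => t * W (x + a *: (t *: v) + b *: (t *: u))) (t * W x) (e * t).
  rewrite scale1r scale0r addr0; apply=> b; last first.
    move=> hb; rewrite -mulrBr normrM (gtr0_norm t0) mulrC ler_pM2r //.
    exact: nearx.
  have -> : t * W (x + a *: (t *: v) + b *: (t *: u)) =
       'd Fv (x + a *: (t *: v) + b *: (t *: u)) (t *: u) by rewrite [RHS]linearZ.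
  exact: is_derive_line.
(* The derivative in [a] of this difference is [t] times the increment of [Fv] estimated in
   [step1]. *)
have := mvb (fun a : K => F (x + t *: u + a *: (t *: v)) - F (x + a *: (t *: v)))
     (fun a : K => t * Fv (x + t *: u + a *: (t *: v)) - t * Fv (x + a *: (t *: v)))
     (t ^+ 2 * W x) (e * t ^+ 2 *+ 2).
rewrite !scale1r !scale0r !addr0 -mulrnA; apply=> a; last first.
  rewrite [x + t *: u + _]addrAC => /step1 h1.
  set A := Fv _ in h1 *; set B := Fv _ in h1 *.
  have -> : t * A - t * B - t ^+ 2 * W x = t * (A - B - t * W x) by ring.
  have -> : e * t ^+ 2 *+ 2 = t * (e * t *+ 2) by ring.
  by rewrite normrM (gtr0_norm t0) ler_pM2l.
have lin y : t * Fv y = 'd F y (t *: v) by rewrite [RHS]linearZ.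
rewrite !lin; apply: is_deriveB; exact: is_derive_line.
Qed.

(** One and the same second difference approximates both mixed derivatives multiplied by [t ^+ 2],
    up to an arbitrarily small multiple of [t ^+ 2]. *)
Lemma diff_sym (K : numFieldType) (V : normedModType K)
    (F : V -> K) (u v x : V) :
  mean_value_bound K ->
  (forall y, differentiable F y) ->
  (forall w y, differentiable (fun z => 'd F z w) y) ->
  (forall w w', continuous (fun y => 'd (fun z => 'd F z w) y w')) ->
  'd (fun z => 'd F z v) x u = 'd (fun z => 'd F z u) x v.
Proof.
move=> mvb dF dFv cW; set c := LHS; set c' := RHS.
apply/eqP; rewrite -subr_eq0 -normr_eq0; apply/negPn/negP => c0.
(* With this [e] the two errors [e * t ^+ 2 *+ 4] add up to half of [|c - c'| * t ^+ 2], which is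
   the contradiction sought. *)
have e0 : 0 < `|c - c'| / 16%:R by rewrite divr_gt0 ?ltr0n // lt0r c0 /=.
(* The second difference of [F] along [t u] and [t v] is symmetric in [u], [v]. *)
have [r r0 hr] := second_difference_bound mvb dF (dFv v) (@cW v u x) e0.
have [r' r'0 hr'] := second_difference_bound mvb dF (dFv u) (@cW u v x) e0.
(* This [t] lies below both radii without comparing them, the order of [K] being only partial. *)
pose t := r * r' / (r + r').
have rr' : 0 < r + r' by rewrite addr_gt0.
have t0 : 0 < t by rewrite divr_gt0 ?mulr_gt0.
have tr : t < r by rewrite ltr_pdivrMr // ltr_pM2l // ltr_pwDl.
have tr' : t < r' by rewrite ltr_pdivrMr // mulrC ltr_pM2l // ltr_pwDr.
have {hr} := hr t; rewrite t0 tr => /(_ isT) h1.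
have {hr'} := hr' t; rewrite t0 tr' => /(_ isT) h2.
have := lerD h1 h2; rewrite -[X in _ + X]normrN => /(le_trans (ler_normD _ _)).
rewrite -/c -/c' [x + t *: v + t *: u]addrAC.
set A := F _; set B := F _; set C := F _; set D := F _.
have -> : A - B - (C - D) - t ^+ 2 * c - (A - C - (B - D) - t ^+ 2 * c')
   = t ^+ 2 * - (c - c') by ring.
have -> : `|c - c'| / 16 * t ^+ 2 *+ 4 + `|c - c'| / 16 * t ^+ 2 *+ 4
   = t ^+ 2 * (`|c - c'| / 2) by field.
rewrite normrM normrN (gtr0_norm (exprn_gt0 2 t0)) ler_pM2l ?exprn_gt0 //.
rewrite ler_pdivlMr ?ltr0n // ger_pMr ?lt0r ?c0 //=.
by rewrite lern1.
Qed.

(** * Partial derivatives of smooth functions commute *)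

Section SmoothFunctions.
Variables (K : numFieldType) (n : nat).
Implicit Types (f : 'rV[K]_n -> K) (s : seq 'I_n).

Lemma smooth_differentiable f x : smooth f -> differentiable f x.
Proof. by move=> /(_ 1)[+ _]; apply. Qed.

Lemma smooth_diff f v : smooth f -> smooth (fun x => 'd f x v).
Proof. by move=> hf p; have [_] := hf p.+1; apply. Qed.

Lemma partialE f j : smooth f -> partial j f = (fun x => 'd f x (delta_mx 0 j)).
Proof.
by move=> hf; apply/funext => x; rewrite /partial deriveE //; exact: smooth_differentiable.
Qed.

Lemma smooth_partial j f : smooth f -> smooth (partial j f).
Proof. by move=> hf; rewrite partialE //; exact: smooth_diff. Qed.

Lemma smooth_partials s f : smooth f -> smooth (partials s f).
Proof. by move=> hf; elim: s => //= j s; exact: smooth_partial. Qed.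

Hypothesis mvb : mean_value_bound K.

Lemma partialC j j' f : smooth f ->
  partial j (partial j' f) = partial j' (partial j f).
Proof.
move=> hf; apply/funext => x.
rewrite ![partial _ (partial _ f)]partialE; try exact: smooth_partial.
rewrite (partialE j) // (partialE j') //.
apply: diff_sym => //.
- by move=> y; exact: smooth_differentiable.
- by move=> w y; apply: smooth_differentiable; exact: smooth_diff.
- by move=> w w'; apply: (smooth_diff _ (smooth_diff _ hf) 0).
Qed.

(** [iter_diff] applies the derivative of its first index innermost, whereas [partials] applies it
    outermost; this reconciles the two. *)
Lemma partials_partial j s f : smooth f ->
  partials s (partial j f) = partials (j :: s) f.
Proof.
by move=> hf; elim: s => //= j' s ->; rewrite /= partialC //; exact: smooth_partials.
Qed.

Lemma perm_partials s s' f : smooth f -> perm_eq s s' ->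
  partials s f = partials s' f.
Proof.
move=> hf; elim: s s' => [|j s IH] s'; first by move=> /perm_size/esym/size0nil ->.
move=> hp; have js' : j \in s' by rewrite -(perm_mem hp) mem_head.
case/splitPr: js' hp => s1 s2.
rewrite perm_sym perm_catC /= perm_cons perm_catC perm_sym => /IH /= ->.
by elim: s1 => //= j' s1 <-; rewrite partialC //; exact: smooth_partials.
Qed.

End SmoothFunctions.

(** * Iterated differentials: symmetry, coordinates, product rule *)

Lemma is_derive_big (K : numFieldType) (V : normedModType K) (T : Type)
    (r : seq T) (P : pred T) (F : T -> V -> K) (dF : T -> K) (x u : V) :
  (forall t, P t -> is_derive x u (F t) (dF t)) ->
  is_derive x u (fun y => \sum_(t <- r | P t) F t y) (\sum_(t <- r | P t) dF t).
Proof.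
move=> hF.
rewrite (_ : (fun y => _) = \sum_(t <- r | P t) F t); last first.
  by apply/funext => y; rewrite fct_sumE.
elim/big_ind2: _ => // [|F1 d1 F2 d2 h1 h2]; first exact: is_derive_cst.
exact: is_deriveD.
Qed.

Section IteratedDifferential.
Variables (K : numFieldType) (m : nat).
Implicit Types (f : 'rV[K]_m -> K) (vs : seq 'rV[K]_m).

(* [iter_diff [:: v_1; ...; v_p] f y] is the value at (v_1, ..., v_p) of the
   p-th differential of [f] at [y], written as a polynomial in the partial
   derivatives of [f]. *)
Fixpoint iter_diff vs f (y : 'rV[K]_m) : K :=
  if vs is v :: vs' then \sum_j v 0 j * iter_diff vs' (partial j f) y else f y.

Hypothesis mvb : mean_value_bound K.

(** Moving [v] past one vector exchanges two sums over coordinates, and Schwarz's theorem restores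
    the order of the derivatives. *)
Lemma iter_diff_catCA vs v vs' f y : smooth f ->
  iter_diff (vs ++ v :: vs') f y = iter_diff (v :: vs ++ vs') f y.
Proof.
elim: vs f => //= w vs IH f hf.
under eq_bigr => j _ do rewrite (IH _ (smooth_partial _ hf)) /= big_distrr /=.
rewrite exchange_big /=; apply: eq_bigr => j _; rewrite big_distrr /=.
by apply: eq_bigr => j' _; rewrite mulrCA (partialC mvb).
Qed.

Lemma perm_iter_diff vs vs' f y : smooth f -> perm_eq vs vs' ->
  iter_diff vs f y = iter_diff vs' f y.
Proof.
elim: vs vs' f => [|v vs IH] vs' f hf.
  by move=> /perm_size/esym/size0nil ->.
move=> hp; have vvs' : v \in vs' by rewrite -(perm_mem hp) mem_head.
case/splitPr: vvs' hp => s1 s2.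
rewrite perm_sym perm_catC /= perm_cons perm_catC perm_sym => hp.
rewrite iter_diff_catCA //=; apply: eq_bigr => j _.
by congr (_ * _); apply: IH => //; exact: smooth_partial.
Qed.

Lemma iter_diff_tuple (T : Type) (s : seq T) (v : T -> 'rV[K]_m) f y : smooth f ->
  iter_diff [seq v t | t <- s] f y =
  \sum_(w : (size s).-tuple 'I_m)
    partials w f y * \prod_(p <- zip s w) v p.1 0 p.2.
Proof.
elim: s f => [|t s IH] f hf /=.
  by rewrite (big_pred1 [tuple]) ?big_nil ?mulr1 // => w; apply/esym/eqP; exact: tuple0.
rewrite (reindex (fun p : 'I_m * (size s).-tuple 'I_m =>
  [tuple of p.1 :: p.2])) /=; last first.
  exists (fun w => (thead w, [tuple of behead w])) => [[j w] _|w _] /=.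
    by congr pair; apply: val_inj.
  by rewrite [RHS]tuple_eta; apply: val_inj.
rewrite -(pair_big predT predT (fun (j : 'I_m) (w : (size s).-tuple 'I_m) =>
   partials (j :: w) f y *
   \prod_(p <- zip (t :: s) (j :: w)) v p.1 0 p.2)) /=.
apply: eq_bigr => j _; rewrite IH; last exact: smooth_partial.
rewrite big_distrr /=; apply: eq_bigr => w _.
by rewrite big_cons /= mulrCA (partials_partial mvb).
Qed.

(** A list meeting each element of [T] once turns index tuples into functions on [T]. With [T] the
    pairs e:nu, all the indices l_{e:nu} become one function [l]. *)
Lemma iter_diff_ffun (T : finType) (s : seq T) (v : T -> 'rV[K]_m) f y :
  smooth f -> uniq s -> (forall t, t \in s) ->
  iter_diff [seq v t | t <- s] f y =
  \sum_(l : {ffun T -> 'I_m})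
    partials [seq l t | t <- s] f y * \prod_t v t 0 (l t).
Proof.
move=> hf us hs; rewrite iter_diff_tuple //.
have hidx t : (index t s < size s)%N by rewrite index_mem.
rewrite (reindex (fun l : {ffun T -> 'I_m} => map_tuple l (in_tuple s))) /=; last first.
  exists (fun w => [ffun t => tnth w (Ordinal (hidx t))]) => [l _|w _].
    apply/ffunP => t; rewrite ffunE tnth_map (tnth_nth t) /=.
    by rewrite nth_index.
  apply: eq_from_tnth => k; rewrite tnth_map ffunE; congr tnth.
  by apply: val_inj; rewrite /= (tnth_nth (tnth (in_tuple s) k)) index_uniq.
apply: eq_bigr => l _; congr (_ * _).
have -> : zip s [seq l t | t <- s] = [seq (t, l t) | t <- s].
  by elim: (s) => //= t s' ->.
rewrite big_map -big_enum /=; apply: perm_big; apply: uniq_perm.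
- by [].
- exact: enum_uniq.
- by move=> t; rewrite mem_enum hs.
Qed.

(** This is the product rule for a multilinear form. The induction replaces [f] by its partial
    derivatives, so the chain rule is assumed for every smooth [phi]; it reaches the base function
    last, so [dG] comes at the end of the list. *)
Lemma is_derive_iter_diff (U : normedModType K) (T : eqType) (s : seq T)
    (V dV : T -> U -> 'rV[K]_m) (G : U -> 'rV[K]_m) (dG : 'rV[K]_m) f (x u : U) :
  smooth f -> uniq s ->
  (forall phi, smooth phi ->
    is_derive x u (fun y => phi (G y)) (\sum_j dG 0 j * partial j phi (G x))) ->
  (forall t j, is_derive x u (fun y => V t y 0 j) (dV t x 0 j)) ->
  is_derive x u (fun y => iter_diff [seq V t y | t <- s] f (G y))
    (iter_diff (rcons [seq V t x | t <- s] dG) f (G x) +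
     \sum_(t <- s) iter_diff
        [seq (if t' == t then dV t x else V t' x) | t' <- s] f (G x)).
Proof.
move=> hf + hG hV; elim: s f hf => [|t s IH] f hf /=.
  by rewrite big_nil addr0 => _; exact: hG.
move=> /andP[ts us].
have D j := is_deriveM (hV t j) (IH _ (smooth_partial j hf) us).
apply: is_derive_eq (is_derive_big (index_enum _) (P := predT) (fun j _ => D j)) _.
rewrite big_cons eqxx /= addrCA.
(* By uniqueness [t] is not in [s], so replacing its vector leaves the tail unchanged. *)
have -> : [seq (if t' == t then dV t x else V t' x) | t' <- s] = [seq V t' x | t' <- s].
  by apply/eq_in_map => t' /=; case: eqP => // -> t's; rewrite t's in ts.
rewrite [X in _ = _ + (_ + X)](_ : _ = \sum_j V t x 0 j *
    \sum_(t1 <- s) iter_diff [seq (if t' == t1 then dV t1 x else V t' x) | t' <- s]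
       (partial j f) (G x)); last first.
  rewrite exchange_big; apply: eq_bigr => j _; rewrite big_distrr.
  apply: eq_big_seq => t1 t1s; case: eqP => // tt1.
  by rewrite tt1 t1s in ts.
rewrite -!big_split; apply: eq_bigr => j _ /=.
by rewrite /GRing.scale /= mulrDr addrC [dV _ _ _ _ * _]mulrC.
Qed.

End IteratedDifferential.

(** * Set partitions of a set with one more element *)

Section PartitionInsertion.
(* [classical_sets] shadows [partition], [setP], [subsetP], ... *)
Import mathcomp.boot.fintype mathcomp.boot.finset.

Lemma setD1_notin (T : finType) (x : T) (A : {set T}) : x \notin A -> A :\ x = A.
Proof.
by move=> xA; apply/setP => y; rewrite !inE; case: eqP => // ->; rewrite (negPf xA).
Qed.

Variables (T : finType) (a : T) (A : {set T}).
Hypothesis aA : a \notin A.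
Implicit Types (P Q : {set {set T}}) (B : {set T}).

(* Below, [B] is the block that receives [a]; [B = set0] stands for the creation
   of the new block [[set a]]. *)
Lemma partition_notin P B : partition P A -> B \in set0 |: P -> a \notin B.
Proof.
move=> hP /setU1P[->|BP]; first by rewrite inE.
by apply: contraNN aA => aB; apply: (subsetP (partitionS hP BP)).
Qed.

Lemma partition_setU1 P B : partition P A -> B \in set0 |: P ->
  partition ((a |: B) |: (P :\ B)) (a |: A).
Proof.
move=> hP hB; have aB := partition_notin hP hB.
have hD : partition (P :\ B) (A :\: B).
  move/setU1P: hB => [->|BP]; last exact: partitionD1.
  by rewrite setD1_notin ?(partition0 hP) // setD0.
have BA : B \subset A by move/setU1P: hB => [->|/(partitionS hP) //]; rewrite sub0set.
have -> : a |: A = (a |: B) :|: (A :\: B).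
  by rewrite -setUA; congr (_ :|: _); rewrite -{1}(setID A B) (setIidPr BA).
apply: partitionU1 => //; first by apply/set0Pn; exists a; rewrite setU11.
rewrite -setI_eq0 setIUl setU_eq0 !setI_eq0 disjoints1 inE (negPf aA) andbF /=.
by rewrite -setI_eq0 setIDA setDIl setDv set0I.
Qed.

Lemma partition_setU1K P B : partition P A -> B \in set0 |: P ->
  let P' := (a |: B) |: (P :\ B) in
  let Q := pblock P' a in
  Q :\ a = B /\ (B |: (P' :\ Q)) :\ set0 = P.
Proof.
move=> hP hB P' Q; have aB := partition_notin hP hB.
have QE : Q = a |: B.
  apply: def_pblock; rewrite ?setU11 //.
  exact: partition_trivIset (partition_setU1 hP hB).
have aBP : a |: B \notin P :\ B.
  apply/negP => /setD1P[_ /(partitionS hP)/subsetP/(_ a)].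
  by rewrite setU11 (negPf aA) => /(_ isT).
rewrite QE setU1K // /P' setU1K //; split=> //.
have P0 : set0 \notin P by rewrite (partition0 hP).
move/setU1P: hB => [->|BP]; last first.
  by rewrite setD1K // setD1_notin.
apply/setP => X; rewrite !inE; case: eqP => [->|] //=.
by rewrite (negPf P0).
Qed.

(** Conversely, deleting [a] from its block undoes an insertion; [B = set0] occurs exactly when [a]
    formed a singleton block. *)
Lemma partition_setD1 P' : partition P' (a |: A) ->
  let Q := pblock P' a in
  let B := Q :\ a in
  let P := (B |: (P' :\ Q)) :\ set0 in
  [/\ partition P A, B \in set0 |: P & (a |: B) |: (P :\ B) = P'].
Proof.
move=> hP' Q B P.
have QP' : Q \in P' by rewrite pblock_mem // (cover_partition hP') setU11.
have aQ : a \in Q by rewrite mem_pblock (cover_partition hP') setU11.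
have hD := partitionD1 hP' QP'.
have D0 : set0 \notin P' :\ Q by rewrite (partition0 hD).
have QA : Q \subset a |: A := partitionS hP' QP'.
have BA : B \subset A.
  apply/subsetP => x /setD1P[xa xQ].
  by have := subsetP QA x xQ; rewrite !inE (negPf xa).
have AE : (a |: A) :\: Q = A :\: B.
  apply/setP => x; rewrite !inE; case: eqP => [->|] //=.
  by rewrite aQ (negPf aA) ?andbF.
have BD : B \notin P' :\ Q.
  apply: contra D0 => BD; suff <- : B = set0 by [].
  have := partitionS hD BD; rewrite AE => BAB.
  apply/eqP; rewrite -subset0; apply/subsetP => x xB.
  by have := subsetP BAB x xB; rewrite in_setD xB.
have PE : P = if B == set0 then P' :\ Q else B |: (P' :\ Q).
  rewrite /P; case: eqP => [->|/eqP B0]; last first.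
    by rewrite setD1_notin // in_setU1 eq_sym negb_or B0.
  by rewrite setU1K.
split.
- rewrite PE; case: eqP => B0; first by rewrite -[A]setD0 -B0 -AE.
  rewrite -[A](setID A B) (setIidPr BA) -AE; apply: partitionU1 => //; first exact/eqP.
  rewrite AE -setI_eq0; apply/eqP/setP => x; rewrite !inE.
  by case: eqP => //= _; case: (x \in Q).
- rewrite PE; case: (B =P set0) => [->|_]; first by rewrite setU11.
  by rewrite !inE eqxx orbT.
have -> : a |: B = Q by rewrite setD1K.
have -> : P :\ B = P' :\ Q.
  apply/setP => X; rewrite 2!in_setD1 in_setU1.
  have [->|XB] := eqVneq X B => /=; first by rewrite (negPf BD).
  by have [->|] := eqVneq X set0 => //=; rewrite (negPf D0).
by rewrite setD1K.
Qed.

(** Insertion is a bijection from the pairs of a partition [P] of [A] and some [B] in [set0 |: P]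
    onto the partitions of [a |: A]; the choice [B = set0] gives the separate term. *)
Lemma big_partition_setU1 (R : Type) (idx : R) (op : Monoid.com_law idx)
    (F : {set {set T}} -> R) :
  \big[op/idx]_(P | partition P (a |: A)) F P =
  \big[op/idx]_(P | partition P A)
     op (F ([set a] |: P)) (\big[op/idx]_(B in P) F ((a |: B) |: (P :\ B))).
Proof.
transitivity (\big[op/idx]_(P | partition P A)
     \big[op/idx]_(B in set0 |: P) F ((a |: B) |: (P :\ B))); last first.
  apply: eq_bigr => P hP; rewrite big_setU1 ?(partition0 hP) //= setU0.
  by rewrite setD1_notin ?(partition0 hP).
rewrite pair_big_dep /=.
rewrite (reindex_onto (fun p : {set {set T}} * {set T} => (a |: p.2) |: (p.1 :\ p.2))
  (fun P' => let Q := pblock P' a in let B := Q :\ a in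
             ((B |: (P' :\ Q)) :\ set0, B))) /=; last first.
  by move=> P' /partition_setD1[].
apply: eq_bigl => -[P B] /=.
apply/andP/andP => [[/partition_setD1[h1 h2 _] /eqP[E1 E2]]|[hP hB]].
  by rewrite E1 in h1 h2; rewrite E2 in h2.
split; first exact: partition_setU1.
by have [-> ->] := partition_setU1K hP hB.
Qed.

End PartitionInsertion.

(** * Derivatives of a composite as sums over set partitions *)

Section PartitionFormula.
Import mathcomp.boot.fintype mathcomp.boot.finset.

Lemma perm_enum_setU1 (T : finType) (a : T) (A : {set T}) : a \notin A ->
  perm_eq (enum (a |: A)) (a :: enum A).
Proof.
move=> aA; apply: uniq_perm => /=; rewrite ?enum_uniq ?mem_enum ?aA //.
by move=> x; rewrite in_cons !mem_enum in_setU1.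
Qed.

Variables (K : numFieldType) (n m : nat).
Hypothesis mvb : mean_value_bound K.
Variables (g : 'I_m -> 'rV[K]_n -> K) (f : 'rV[K]_m -> K).
Hypotheses (hg : forall j, smooth (g j)) (hf : smooth f).
Variables (I : finType) (i : I -> 'I_n).

Let G (x : 'rV[K]_n) : 'rV[K]_m := \row_(j < m) g j x.

(** [enum] fixes some order of differentiation; Schwarz's theorem allows any other. *)
Definition block_deriv (B : {set I}) (x : 'rV[K]_n) : 'rV[K]_m :=
  \row_j partials [seq i a | a <- enum B] (g j) x.

Definition partition_term (P : {set {set I}}) (x : 'rV[K]_n) : K :=
  iter_diff [seq block_deriv B x | B <- enum P] f (G x).

Lemma diff_row x u :
  differentiable G x /\ 'd G x u = \sum_j 'D_u (g j) x *: delta_mx 0 j.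
Proof.
have dg j : differentiable (g j) x by exact: smooth_differentiable.
have dgZ j : differentiable (fun y => g j y *: (delta_mx 0 j : 'rV[K]_m)) x.
  exact: differentiableZl.
have -> : G = \sum_(j < m) (fun y => g j y *: delta_mx 0 j).
  apply/funext => y; rewrite fct_sumE [LHS]row_sum_delta.
  by apply: eq_bigr => j _; rewrite mxE.
have dG := differentiable_sum dgZ; split=> //.
rewrite -deriveE // derive_sum; last by move=> j; exact: diff_derivable.
by apply: eq_bigr => j _; rewrite deriveE // diffZl // deriveE.
Qed.

Lemma is_derive_comp_row (phi : 'rV[K]_m -> K) x u : smooth phi ->
  is_derive x u (fun y => phi (G y)) (\sum_j 'D_u (g j) x * partial j phi (G x)).
Proof.
move=> hphi.
have dphi : differentiable phi (G x) by exact: smooth_differentiable.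
have [dG dGE] := diff_row x u.
split; first by apply: diff_derivable; exact: differentiable_comp.
rewrite deriveE; last exact: differentiable_comp.
rewrite (diff_comp dG dphi) /= dGE.
rewrite linear_sum; apply: eq_bigr => j _.
by rewrite linearZ /= -deriveE.
Qed.

(** In the product rule for iterated differentials, the derivative of [G] is the vector of the new
    block [[set a]], and differentiating the vector of [B] yields that of [a |: B]. *)
Lemma is_derive_partition_term (a : I) (P : {set {set I}}) (A : {set I}) x :
  a \notin A -> partition P A ->
  is_derive x (delta_mx 0 (i a)) (partition_term P)
    (partition_term ([set a] |: P) x
     + \sum_(B in P) partition_term ((a |: B) |: (P :\ B)) x).
Proof.
move=> aA hP.
have aP B : B \in P -> a \notin B.
  by move=> BP; apply: (partition_notin aA hP); rewrite in_setU1 BP orbT.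
pose dV (B : {set I}) (y : 'rV[K]_n) : 'rV[K]_m :=
  \row_j partial (i a) (partials [seq i b | b <- enum B] (g j)) y.
have dVE (B : {set I}) y : a \notin B -> dV B y = block_deriv (a |: B) y.
  move=> aB; apply/rowP => j; rewrite !mxE.
  have hp := perm_map i (perm_enum_setU1 aB).
  by rewrite (perm_partials mvb (hg j) hp).
have := @is_derive_iter_diff _ _ _ _ (enum P) block_deriv dV G (block_deriv [set a] x) f x
  (delta_mx 0 (i a)) hf (enum_uniq P).
case.
- move=> phi hphi; apply: is_derive_eq (is_derive_comp_row x _ hphi) _.
  by apply: eq_bigr => j _; rewrite mxE enum_set1.
- move=> B j.
  rewrite [X in is_derive _ _ X _](_ : _ =
    partials [seq i b | b <- enum B] (g j)); last first.
    by apply/funext => y; rewrite mxE.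
  rewrite mxE; apply: derivableP; apply: diff_derivable.
  by apply: smooth_differentiable; exact: smooth_partials.
move=> h1 h2; split; first by [].
rewrite h2; congr (_ + _).
  apply: perm_iter_diff => //.
  rewrite perm_rcons -(map_cons (block_deriv^~ x)); apply: perm_map.
  rewrite perm_sym; apply: perm_enum_setU1.
  by apply/negP => /aP; rewrite set11.
rewrite big_enum; apply: eq_bigr => B BP; apply: perm_iter_diff => //.
have -> : [seq (if B' == B then dV B x else block_deriv B' x) | B' <- enum P]
  = [seq block_deriv B' x | B' <- [seq (if B' == B then a |: B else B') | B' <- enum P]].
  by rewrite -map_comp; apply: eq_map => B' /=; case: eqP => // _; rewrite dVE ?aP.
apply: perm_map.
(* Hence replacing [B] by [a |: B] in [enum P] creates no repetition, and the result lists the new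
   partition. *)
have aBP : a |: B \notin P by apply/negP => /aP; rewrite setU11.
apply: uniq_perm; rewrite ?enum_uniq //.
  rewrite map_inj_in_uniq ?enum_uniq // => B1 B2; rewrite !mem_enum => B1P B2P.
  case: eqP => [->|_]; case: eqP => [->|_] // E.
    by rewrite E B2P in aBP.
  by rewrite -E B1P in aBP.
move=> X; rewrite mem_enum !inE; apply/mapP/idP => [[B' + ->]|].
  rewrite mem_enum => B'P.
  by case: (B' =P B) => [_|/eqP B'B]; rewrite ?eqxx // B'B B'P orbT.
case/orP => [/eqP ->|/andP[XB XP]].
  by exists B; rewrite ?mem_enum ?eqxx.
by exists X; rewrite ?mem_enum // (negPf XB).
Qed.

(** Existence is proved along with the formula: the formula for the tail holds at every point, so it
    can be differentiated once more. *)
Lemma partials_comp_partition (s : seq I) : uniq s ->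
  let h x := f (G x) in
  has_partials [seq i a | a <- s] h /\
  forall x, partials [seq i a | a <- s] h x
    = \sum_(P | partition P [set a in s]) partition_term P x.
Proof.
move=> + h; elim: s => [_|a s IH /= /andP[as_ us]].
  split=> // x; rewrite (big_pred1 set0) => [|P]; last first.
    by rewrite set_nil partition_set0.
  by rewrite /partition_term enum_set0.
have [h1 h2] := IH us.
have aA : a \notin [set b in s] by rewrite inE.
have D x : is_derive x (delta_mx 0 (i a)) (partials [seq i b | b <- s] h)
   (\sum_(P | partition P [set b in a :: s]) partition_term P x).
  rewrite (_ : partials _ h = fun y =>
      \sum_(P | partition P [set b in s]) partition_term P y);
    last exact/funext.
  rewrite set_cons big_partition_setU1 //.
  apply: (is_derive_big _ (F := partition_term)) => P hP.
  exact: (is_derive_partition_term x aA hP).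
split; last by move=> x; have [_ <-] := D x.
by split=> // x; have [] := D x.
Qed.

End PartitionFormula.

(** * Coset representatives and set partitions of a given type *)

Section BlockPartitions.
Import mathcomp.boot.fintype mathcomp.boot.finset.

Section Blocks.
Variables (k d : nat) (lam mu : {ffun 'I_d -> 'I_k.+2}).
Hypotheses (lamP : lam_ok lam) (muP : mu_ok lam mu).

Lemma lam_gt0 e : (0 < lam e)%N.
Proof. by case/andP: lamP => /forallP. Qed.

Lemma lam_ltn (e e' : 'I_d) : (e < e')%N -> (lam e < lam e')%N.
Proof. by case/andP: lamP => _ /forallP/(_ e)/forallP/(_ e')/implyP. Qed.

Lemma lam_inj (e e' : 'I_d) : lam e = lam e' :> nat -> e = e'.
Proof.
move=> E; apply: val_inj; case: (ltngtP e e') => // /lam_ltn; by rewrite E ltnn.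
Qed.

Lemma mu_gt0 e : (0 < mu e)%N.
Proof. by case/andP: muP => /forallP. Qed.

Lemma sum_mu_lam : (\sum_(e < d) mu e * lam e = k.+1)%N.
Proof. by case/andP: muP => _ /eqP. Qed.

(** This is the zero-based rank of the first triple with index [e]. *)
Let off (e : 'I_d) := (\sum_(e' < d | (e' < e)%N) mu e' * lam e')%N.

Lemma off_lt (e e' : 'I_d) : (e < e')%N -> (off e + mu e * lam e <= off e')%N.
Proof.
move=> ee'; rewrite /off [X in (_ <= X)%N](bigD1 e) //= addnC leq_add2l.
rewrite [X in (_ <= X)%N]big_mkcond [X in (X <= _)%N]big_mkcond /=; apply: leq_sum => a _.
case: (ltnP a e) => // ae; rewrite (ltn_trans ae ee') /= -(inj_eq val_inj) /=.
by rewrite neq_ltn ae.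
Qed.

Lemma off_le (e : 'I_d) : (off e + mu e * lam e <= k.+1)%N.
Proof.
rewrite -[leqRHS]sum_mu_lam [leqRHS](bigD1 e) //= addnC leq_add2l /off.
rewrite [X in (_ <= X)%N]big_mkcond [X in (X <= _)%N]big_mkcond /=; apply: leq_sum => a _.
case: (ltnP a e) => // ae; rewrite -(inj_eq val_inj) /=.
by rewrite neq_ltn ae.
Qed.

Lemma rank_lt (e : 'I_d) (nu : 'I_(mu e)) (gamma : 'I_(lam e)) :
  (off e + nu * lam e + gamma < off e + mu e * lam e)%N.
Proof.
rewrite -addnA ltn_add2l (@leq_trans (nu.+1 * lam e)%N) //.
  by rewrite mulSn addnC ltn_add2r.
by rewrite leq_mul2r ltn_ord orbT.
Qed.

(** The rank stays below [k.+1], so [inord] does not fall back on its default. *)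
Lemma val_triple (e : 'I_d) (nu : 'I_(mu e)) (gamma : 'I_(lam e)) :
  triple nu gamma = (off e + nu * lam e + gamma)%N :> nat.
Proof. by rewrite /triple inordK // (leq_trans (rank_lt _ _)) // off_le. Qed.

Let triple' (t : {e : 'I_d & ('I_(mu e) * 'I_(lam e))%type}) : 'I_k.+1 :=
  triple (tagged t).1 (tagged t).2.

(** Ranks with different [e] lie in disjoint intervals; inside one interval, division by [lam e]
    recovers [nu], and then [gamma] remains. *)
Lemma triple_inj : injective triple'.
Proof.
move=> [e [nu gam]] [e' [nu' gam']] /(congr1 val); rewrite /= !val_triple /= => E.
have ee' : e = e'.
  apply: val_inj; case: (ltngtP e e') => // /off_lt.
    by move/(leq_trans (rank_lt nu gam)); rewrite {}E -addnA ltnNge leq_addr.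
  by move/(leq_trans (rank_lt nu' gam')); rewrite -{}E -addnA ltnNge leq_addr.
subst e'; move: E; rewrite -!addnA => /addnI E.
have nunu' : nu = nu'.
  apply: val_inj; have := congr1 (fun x => x %/ lam e)%N E.
  by rewrite /= !divnMDl ?lam_gt0 // !divn_small // !addn0.
by subst nu'; move/addnI: E => /val_inj ->.
Qed.

Lemma triple_bij : bijective triple'.
Proof.
apply: (inj_card_bij triple_inj).
rewrite card_ord card_tagged sumnE big_map big_enum /= -[leqLHS]sum_mu_lam.
by apply: leq_sum => e _; rewrite card_prod !card_ord.
Qed.

Implicit Types (p : {e : 'I_d & 'I_(mu e)}) (s : 'S_k.+1).

Definition perm_block s p : {set 'I_k.+1} := s @: block lam (tagged p).

Definition perm_partition s : {set {set 'I_k.+1}} :=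
  [set perm_block s p | p : {e : 'I_d & 'I_(mu e)}].

Lemma triple_injr (e : 'I_d) (nu : 'I_(mu e)) :
  injective (fun gamma : 'I_(lam e) => triple nu gamma).
Proof.
move=> gam gam' E.
have := @triple_inj (Tagged (fun e => ('I_(mu e) * 'I_(lam e))%type) (nu, gam))
                    (Tagged (fun e => ('I_(mu e) * 'I_(lam e))%type) (nu, gam')) E.
by move/eqP; rewrite eq_Tagged /= => /eqP[].
Qed.

Lemma card_perm_block s p : #|perm_block s p| = lam (tag p).
Proof.
rewrite card_imset; last exact: perm_inj.
by rewrite card_imset ?card_ord //; exact: triple_injr.
Qed.

Lemma perm_block_eq s p p' x : x \in perm_block s p -> x \in perm_block s p' -> p = p'.
Proof.
case/imsetP=> _ /imsetP[gam _ ->] -> /imsetP[_ /imsetP[gam' _ ->]] /perm_inj.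
case: p gam => e nu gam; case: p' gam' => e' nu' gam' E.
have := @triple_inj (Tagged (fun e => ('I_(mu e) * 'I_(lam e))%type) (nu, gam))
                    (Tagged (fun e => ('I_(mu e) * 'I_(lam e))%type) (nu', gam')) E.
by move=> /(congr1 (fun t : {e : 'I_d & ('I_(mu e) * 'I_(lam e))%type} =>
      Tagged (fun e => 'I_(mu e)) (tagged t).1)).
Qed.

Lemma perm_block_inj s : injective (perm_block s).
Proof.
move=> p p' E; have /card_gt0P[x xp] : (0 < #|perm_block s p|)%N.
  by rewrite card_perm_block lam_gt0.
by apply: (perm_block_eq xp); rewrite -E.
Qed.

Lemma perm_partitionP s : partition (perm_partition s) [set: 'I_k.+1].
Proof.
apply/and3P; split.
- rewrite -subTset; apply/subsetP => x _.
  have [t' _ K'] := triple_bij.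
  apply/bigcupP; pose t := t' ((s^-1)%g x).
  exists (perm_block s (Tagged (fun e => 'I_(mu e)) (tagged t).1)).
    exact: imset_f.
  apply/imsetP; exists ((s^-1)%g x); last by rewrite permKV.
  by apply/imsetP; exists (tagged t).2 => //; rewrite -[LHS]K'.
- apply/trivIsetP => _ _ /imsetP[p _ ->] /imsetP[p' _ ->].
  apply: contraR => /pred0Pn[x /andP[/= xp xp']].
  by rewrite (perm_block_eq xp xp').
apply/imsetP => -[p _] /(congr1 (fun A : {set _} => #|A|)).
by rewrite cards0 card_perm_block => /esym/eqP; rewrite -leqn0 leqNgt lam_gt0.
Qed.

Definition partition_type (P : {set {set 'I_k.+1}}) : bool :=
  [forall e, #|[set B in P | #|B| == lam e]| == mu e] &&
  [forall B in P, exists e, #|B| == lam e].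

Lemma perm_partition_type s : partition_type (perm_partition s).
Proof.
apply/andP; split.
  apply/forallP => e; apply/eqP.
  (* Since [lam] is injective, the blocks of size [lam e] are exactly those with tag [e]. *)
  have -> : [set B in perm_partition s | #|B| == lam e]
     = [set perm_block s (Tagged (fun e => 'I_(mu e)) nu) | nu : 'I_(mu e)].
    apply/setP => B; rewrite inE; apply/andP/imsetP => [[/imsetP[[e' nu] _ ->]]|[nu _ ->]].
      rewrite card_perm_block /= => /eqP /lam_inj ee'; subst e'.
      by exists nu.
    by rewrite imset_f // card_perm_block.
  rewrite card_imset ?card_ord // => nu nu' /perm_block_inj /eqP.
  by rewrite eq_Tagged => /eqP.
apply/forall_inP => _ /imsetP[p _ ->]; apply/existsP; exists (tag p).
by rewrite card_perm_block.
Qed.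

(** Both sides say that [s] followed by the inverse of [s'] permutes the standard blocks; such a map
    preserves sizes, hence the index [e]. *)
Lemma perm_partition_eq s s' :
  (perm_partition s == perm_partition s') = (s \in block_perms lam mu :* s')%g.
Proof.
rewrite mem_rcoset; apply/eqP/idP => [E|].
  rewrite inE; apply/forallP => e; apply/forallP => nu; apply/existsP.
  have : perm_block s (Tagged (fun e => 'I_(mu e)) nu) \in perm_partition s'.
    by rewrite -E imset_f.
  case/imsetP => -[e' nu'] _ Ep.
  have := congr1 (fun A : {set _} => #|A|) Ep; rewrite !card_perm_block /= => /lam_inj ee'.
  subst e'; exists nu'; apply/eqP.
  rewrite (_ : (_ @: _) = (s'^-1)%g @: perm_block s (Tagged (fun e => 'I_(mu e)) nu)).
    rewrite Ep -imset_comp -[RHS]imset_id.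
    exact: (eq_imset _ (permK s')).
  by rewrite /perm_block -imset_comp; exact: (eq_imset _ (permM s s'^-1%g)).
rewrite inE => /forallP H.
(* Both partitions have one block for each pair e:nu, so one inclusion suffices. *)
apply/eqP; rewrite eqEcard !card_imset ?leqnn ?andbT; try exact: perm_block_inj.
apply/subsetP => _ /imsetP[[e nu] _ ->].
have /forallP/(_ nu)/existsP[nu' /eqP Enu] := H e.
apply/imsetP; exists (Tagged (fun e => 'I_(mu e)) nu') => //=.
rewrite /perm_block /= -Enu -[RHS]imset_comp.
have E : s =1 s' \o (s * s'^-1)%g by move=> x; rewrite /= permM permKV.
exact: (eq_imset _ E).
Qed.

(** The permutation sends e:nu:gamma to the [gamma]-th element of the [nu]-th block of size [lam e]
    in [P]. *)
Lemma perm_partition_surj P : partition P [set: 'I_k.+1] -> partition_type P ->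
  exists s, perm_partition s = P.
Proof.
move=> hP /andP[/forallP hmu _].
pose Be e := [set B in P | #|B| == lam e].
pose B p := nth set0 (enum (Be (tag p))) (tagged p).
have hB p : B p \in Be (tag p).
  by rewrite -mem_enum mem_nth // -cardE (eqP (hmu _)).
have BP p : B p \in P by have := hB p; rewrite inE => /andP[].
have cB p : #|B p| = lam (tag p) by have := hB p; rewrite inE => /andP[_ /eqP].
have injB : injective B.
  move=> [e nu] [e' nu'] E; have := cB (Tagged _ nu); rewrite E cB /= => /lam_inj ee'.
  subst e'; congr (Tagged _ _); apply: val_inj; apply/eqP.
  rewrite -(nth_uniq set0 _ _ (enum_uniq (mem (Be e)))) -?cardE ?(eqP (hmu _))
    ?(ltn_ord nu) ?(ltn_ord nu') //.
  exact/eqP.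
pose psi (t : {e : 'I_d & ('I_(mu e) * 'I_(lam e))%type}) : 'I_k.+1 :=
  nth ord0 (enum (B (Tagged (fun e => 'I_(mu e)) (tagged t).1))) (tagged t).2.
have hpsi t : psi t \in B (Tagged (fun e => 'I_(mu e)) (tagged t).1).
  by rewrite -mem_enum mem_nth // -cardE cB.
have injpsi : injective psi.
  case=> e [nu gam]; case=> e' [nu' gam'] E.
  have := hpsi (Tagged (fun e => ('I_(mu e) * 'I_(lam e))%type) (nu, gam)).
  have := hpsi (Tagged (fun e => ('I_(mu e) * 'I_(lam e))%type) (nu', gam')).
  rewrite -E /= => h1 h2.
  have EB : B (Tagged (fun e => 'I_(mu e)) nu) = B (Tagged (fun e => 'I_(mu e)) nu').
    have tI := partition_trivIset hP.
    by rewrite -(def_pblock tI (BP _) h2) (def_pblock tI (BP _) h1).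
  have Ep := injB _ _ EB.
  have ee' : e = e' := congr1 tag Ep.
  subst e'; move/eqP: Ep; rewrite eq_Tagged /= => /eqP nunu'; subst nu'.
  suff -> : gam = gam' by [].
  apply: val_inj; apply/eqP.
  rewrite -(nth_uniq ord0 _ _ (enum_uniq (mem (B (Tagged (fun e => 'I_(mu e)) nu)))))
    -?cardE ?cB ?(ltn_ord gam) ?(ltn_ord gam') //.
  exact/eqP.
have [t' K K'] := triple_bij.
pose s := perm (inj_comp injpsi (can_inj K')).
have sB p : perm_block s p = B p.
  apply/eqP; rewrite eqEcard card_perm_block cB leqnn andbT.
  apply/subsetP => _ /imsetP[_ /imsetP[gam _ ->] ->].
  case: p gam => e nu gam; rewrite permE /=.
  pose t := Tagged (fun e => ('I_(mu e) * 'I_(lam e))%type) (nu, gam).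
  have Et : t' (triple nu gam) = t := K t.
  by rewrite Et; exact: (hpsi t).
exists s; apply/eqP; rewrite eqEsubset; apply/andP; split.
  by apply/subsetP => _ /imsetP[p _ ->]; rewrite sB BP.
(* The blocks of [perm_partition s] lie in [P] and cover everything, so [X] meets one of them and,
   [P] being a partition, equals it. *)
apply/subsetP => X XP.
have /set0Pn[x xX] := partition_neq0 hP XP.
have : x \in cover (perm_partition s) by rewrite (cover_partition (perm_partitionP s)) inE.
case/bigcupP => Y Ys xY; have YP : Y \in P by case/imsetP: Ys => p _ ->; rewrite sB BP.
have tI := partition_trivIset hP.
by rewrite -(def_pblock tI XP xX) (def_pblock tI YP xY).
Qed.

(** A transversal meets each coset exactly once: at most once makes [perm_partition] injective on
    [F], at least once makes it surjective. *)
Lemma big_coset_repr (R : Type) (idx : R) (op : Monoid.com_law idx)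
    (F : {set 'S_k.+1}) (phi : {set {set 'I_k.+1}} -> R) :
  is_coset_repr lam mu F ->
  \big[op/idx]_(s in F) phi (perm_partition s) =
  \big[op/idx]_(P | partition P [set: 'I_k.+1] && partition_type P) phi P.
Proof.
move=> /and3P[_ _ /forall_inP hF].
have inj : {in F &, injective perm_partition}.
  move=> s s' sF s'F /eqP; rewrite perm_partition_eq => ss'.
  have := hF (block_perms lam mu :* s')%g.
  have -> : (block_perms lam mu :* s' \in rcosets (block_perms lam mu) [set: 'S_k.+1])%g.
    by apply/rcosetsP; exists s'; rewrite ?inE.
  move=> /(_ isT)/cards1P[r Er].
  have := set11 r.
  have : s \in [set r] by rewrite -Er inE sF.
  have : s' \in [set r].
    by rewrite -Er inE s'F -perm_partition_eq eqxx.
  by rewrite !inE => /eqP -> /eqP ->.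
rewrite -(big_imset _ inj); apply: eq_bigl => P; apply/imsetP/andP => [[s _ ->]|[h1 h2]].
  by split; [exact: perm_partitionP|exact: perm_partition_type].
have [s0 <-] := perm_partition_surj h1 h2.
have := hF (block_perms lam mu :* s0)%g.
have -> : (block_perms lam mu :* s0 \in rcosets (block_perms lam mu) [set: 'S_k.+1])%g.
  by apply/rcosetsP; exists s0; rewrite ?inE.
move=> /(_ isT)/cards1P[r Er]; have := set11 r; rewrite -Er inE => /andP[rF rs0].
by exists r => //; apply/esym/eqP; rewrite perm_partition_eq.
Qed.

End Blocks.
End BlockPartitions.

(** * Existence and uniqueness of the type of a set partition *)

Section PartitionTypes.
Import mathcomp.boot.fintype mathcomp.boot.finset.
Variables (k : nat).
Implicit Types (P : {set {set 'I_k.+1}}).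

Lemma set_enumT (T : finType) : [set a in enum T] = [set: T].
Proof. by apply/setP => a; rewrite !inE mem_enum. Qed.

(** Filtering an interval of integers yields the distinct sizes already in increasing order, as the
    lambda_e must be. *)
Definition block_sizes P : seq nat :=
  [seq c <- iota 1 k.+1 | c \in [seq #|B| | B : {set 'I_k.+1} in P]].

Lemma sorted_block_sizes P : sorted ltn (block_sizes P).
Proof. by apply: sorted_filter; [exact: ltn_trans | exact: iota_ltn_sorted]. Qed.

Lemma mem_block_sizes P c : partition P [set: 'I_k.+1] ->
  reflect (exists2 B, B \in P & #|B| = c) (c \in block_sizes P).
Proof.
move=> hP; rewrite mem_filter; apply: (iffP andP) => [[/imageP[B BP ->] _]|[B BP <-]].
  by exists B.
split; first by apply/imageP; exists B.
rewrite mem_iota add1n ltnS card_gt0 (partition_neq0 hP BP) /=.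
by rewrite (leq_trans (max_card _)) // card_ord.
Qed.

(** Two strictly increasing lists with the same members are equal; thus [P] determines [d] and
    [lam]. *)
Lemma type_block_sizes d (lam mu : {ffun 'I_d -> 'I_k.+2}) P :
  partition P [set: 'I_k.+1] -> lam_ok lam -> mu_ok lam mu ->
  partition_type lam mu P -> [seq nat_of_ord (lam e) | e <- enum 'I_d] = block_sizes P.
Proof.
move=> hP lamP muP /andP[/forallP hmu /forall_inP hB].
apply: (irr_sorted_eq ltn_trans ltnn) => [||c].
- rewrite sorted_map.
  have : sorted (relpre val ltn) (enum 'I_d).
    by rewrite -sorted_map val_enum_ord iota_ltn_sorted.
  by apply: sub_sorted => e e'; exact: lam_ltn.
- exact: sorted_block_sizes.
apply/mapP/mem_block_sizes => // [[e _ ->]|[B BP <-]].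
  have : (0 < #|[set B in P | #|B| == lam e]|)%N by rewrite (eqP (hmu e)) (mu_gt0 muP).
  by case/card_gt0P => B; rewrite inE => /andP[BP /eqP]; exists B.
by have /existsP[e /eqP ->] := hB B BP; exists e; rewrite ?mem_enum.
Qed.

Lemma partition_type_exists P : partition P [set: 'I_k.+1] ->
  exists lam mu : {ffun 'I_(size (block_sizes P)) -> 'I_k.+2},
    [/\ lam_ok lam, mu_ok lam mu & partition_type lam mu P].
Proof.
move=> hP; set sz := block_sizes P.
pose lam : {ffun 'I_(size sz) -> 'I_k.+2} :=
  [ffun e : 'I_(size sz) => inord (nth 0%N sz e)].
pose num c := #|[set B in P | #|B| == c]|.
pose mu : {ffun 'I_(size sz) -> 'I_k.+2} := [ffun e : 'I_(size sz) => inord (num (lam e))].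
have szB e : (e < size sz)%N -> exists2 B, B \in P & #|B| = nth 0%N sz e.
  by move=> he; apply/mem_block_sizes => //; exact: mem_nth.
have lamE (e : 'I_(size sz)) : lam e = nth 0%N sz e :> nat.
  have [B _ Be] := szB e (ltn_ord e).
  by rewrite ffunE inordK // -Be ltnS (leq_trans (max_card _)) // card_ord.
(* Blocks are nonempty, so their number, and hence every multiplicity, fits into ['I_k.+2]. *)
have cardP : (#|P| <= k.+1)%N.
  rewrite -[leqRHS]card_ord -cardsT (card_partition hP) -sum1_card.
  by apply: leq_sum => B BP; rewrite card_gt0 (partition_neq0 hP).
have muE e : mu e = num (lam e) :> nat.
  rewrite ffunE inordK // ltnS (leq_trans _ cardP) //.
  by apply: subset_leq_card; apply/subsetP => B; rewrite inE => /andP[].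
have lamP : lam_ok lam.
  apply/andP; split.
    apply/forallP => e; rewrite lamE; have [B BP <-] := szB e (ltn_ord e).
    by rewrite card_gt0 (partition_neq0 hP).
  apply/forallP => e; apply/forallP => e'; apply/implyP => ee'; rewrite !lamE.
  by apply: (sorted_ltn_nth ltn_trans 0%N (sorted_block_sizes P)) => //;
    rewrite inE ltn_ord.
have tP : partition_type lam mu P.
  apply/andP; split; first by apply/forallP => e; rewrite muE.
  apply/forall_inP => B BP; have Bsz : #|B| \in sz by apply/mem_block_sizes => //; exists B.
  apply/existsP; have hi : (index #|B| sz < size sz)%N by rewrite index_mem.
  by exists (Ordinal hi); rewrite lamE nth_index.
exists lam, mu; split=> //; apply/andP; split.
  apply/forallP => e; rewrite muE; have [B BP Be] := szB e (ltn_ord e).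
  by apply/card_gt0P; exists B; rewrite inE BP lamE Be /=.
rewrite -[X in _ == X]card_ord -cardsT (card_partition hP).
(* Grouping the blocks by size turns the sum of the [mu e * lam e] into the sum of all block sizes,
   which is [k.+1]. *)
have h (e : 'I_(size sz)) : (mu e * lam e = \sum_(B in P | #|B| == lam e) #|B|)%N.
  rewrite muE -sum_nat_const; apply: eq_big => [B|B]; rewrite inE //.
  by case/andP => _ /eqP ->.
rewrite (eq_bigr _ (fun e _ => h e)).
under eq_bigr => e _ do rewrite big_mkcondr.
rewrite exchange_big /=; apply/eqP; apply: eq_bigr => B BP.
case/andP: tP => _ /forall_inP/(_ B BP)/existsP[e /eqP Be].
rewrite -big_mkcond (big_pred1 e) // => e' /=; rewrite Be.
by apply/eqP/eqP => [/(lam_inj lamP)|->].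
Qed.

(** With the sum over [P] moved outermost, only the unique type of [P] contributes. *)
Lemma big_partition_type (K : nmodType) (phi : {set {set 'I_k.+1}} -> K) :
  \sum_(P | partition P [set: 'I_k.+1]) phi P =
  \sum_(1 <= d < k.+2)
  \sum_(lam : {ffun 'I_d -> 'I_k.+2} | lam_ok lam)
  \sum_(mu : {ffun 'I_d -> 'I_k.+2} | mu_ok lam mu)
  \sum_(P | partition P [set: 'I_k.+1] && partition_type lam mu P) phi P.
Proof.
under [RHS]eq_bigr => d _.
  under eq_bigr => lam _.
    under eq_bigr => mu _ do rewrite big_mkcondr.
    rewrite exchange_big /=.
    over.
  rewrite exchange_big /=.
  over.
rewrite exchange_big /=; apply: eq_bigr => P hP.
have [lam0 [mu0 [lamP0 muP0 type0]]] := partition_type_exists hP.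
have szE := type_block_sizes hP.
(* The types of [lam] and [mu] depend on [d], so [d] is isolated first; it is positive because
   [ord0] lies in some block. *)
rewrite (bigD1_seq (size (block_sizes P))) ?iota_uniq //=; last first.
  rewrite mem_index_iota; apply/andP; split; last first.
    by rewrite ltnS size_filter (leq_trans (count_size _ _)) ?size_iota.
  have : ord0 \in cover P by rewrite (cover_partition hP) inE.
  case/bigcupP => B BP _.
  have : #|B| \in block_sizes P by apply/mem_block_sizes => //; exists B.
  by case: (block_sizes P).
rewrite [X in _ = _ + X]big1 ?addr0; last first.
  move=> d dP; apply: big1 => lam lamP; apply: big1 => mu muP; case: ifP => // tP.
  by move: dP; rewrite -(szE _ _ _ lamP muP tP) size_map size_enum_ord eqxx.
rewrite (bigD1 lam0) //= [X in _ = _ + X]big1 ?addr0; last first.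
  move=> lam /andP[lamP lam0P]; apply: big1 => mu muP; case: ifP => // tP.
  case/negP: lam0P; apply/eqP/ffunP => e; apply: val_inj.
  have /eq_in_map := etrans (szE _ _ _ lamP muP tP) (esym (szE _ _ _ lamP0 muP0 type0)).
  by apply; rewrite mem_enum.
rewrite (bigD1 mu0) //= type0 big1 ?addr0 //.
move=> mu /andP[muP mu0P]; case: ifP => // tP; case/negP: mu0P.
apply/eqP/ffunP => e; apply: val_inj.
have /andP[/forallP/(_ e)/eqP E _] := tP.
have /andP[/forallP/(_ e)/eqP E0 _] := type0.
exact: etrans (esym E) E0.
Qed.

End PartitionTypes.

(** * Coordinate expansion of the term of a set partition *)

Section PartitionTermPerm.
Import mathcomp.boot.fintype mathcomp.boot.finset.

Lemma partition_term_perm (K : numFieldType) (n m : nat) (g : 'I_m -> 'rV[K]_n -> K)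
    (f : 'rV[K]_m -> K) (k d : nat) (i : 'I_k.+1 -> 'I_n)
    (lam mu : {ffun 'I_d -> 'I_k.+2}) (s : 'S_k.+1) (x : 'rV[K]_n) :
  mean_value_bound K -> (forall j, smooth (g j)) -> smooth f ->
  lam_ok lam -> mu_ok lam mu ->
  partition_term g f i (perm_partition lam mu s) x =
  \sum_(l : {ffun {e : 'I_d & 'I_(mu e)} -> 'I_m})
    partials [seq l (Tagged _ nu) | e <- enum 'I_d, nu <- enum 'I_(mu e)]
      f (\row_j g j x) *
    \prod_(e < d) \prod_(nu < mu e)
      partials [seq i (s (triple nu gamma)) | gamma : 'I_(lam e)]
        (g (l (Tagged _ nu))) x.
Proof.
move=> mvb hg hf lamP muP.
(* The pairs e:nu in lexicographic order, as in the derivative of [f] on the right-hand side. *)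
pose ps := [seq Tagged (fun e => 'I_(mu e)) nu | e <- enum 'I_d, nu <- enum 'I_(mu e)].
have ups : uniq ps.
  apply: allpairs_uniq_dep => [|e _|[e nu] [e' nu'] _ _ //]; exact: enum_uniq.
have ps_mem p : p \in ps.
  by case: p => e nu; apply/allpairsPdep; exists e, nu; rewrite !mem_enum.
rewrite /partition_term.
have hp : perm_eq (enum (perm_partition lam mu s)) [seq perm_block lam s p | p <- ps].
  apply: uniq_perm; rewrite ?enum_uniq ?map_inj_uniq //; first exact: perm_block_inj.
  move=> B; rewrite mem_enum; apply/imsetP/mapP => -[p _ ->]; by exists p.
rewrite (perm_iter_diff mvb _ hf (perm_map (block_deriv g i ^~ x) hp)) -map_comp.
rewrite (iter_diff_ffun mvb _ _ hf ups ps_mem).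
apply: eq_bigr => l _; rewrite map_allpairs; congr (_ * _).
rewrite sig_big_dep /=; apply: eq_bigr => -[e nu] _; rewrite mxE /=.
congr (_ x); apply: (perm_partials mvb (hg _)).
suff /(perm_map i) : perm_eq (enum (perm_block lam s (Tagged (fun e => 'I_(mu e)) nu)))
    [seq s (triple nu gamma) | gamma <- enum 'I_(lam e)] by rewrite -map_comp.
apply: uniq_perm => [||a]; first exact: enum_uniq.
  rewrite map_inj_uniq; first exact: enum_uniq.
  by move=> a b /perm_inj; exact: triple_injr.
rewrite mem_enum; apply/imsetP/mapP.
  by case=> _ /imsetP[gam _ ->] ->; exists gam; rewrite ?mem_enum.
by case=> gam _ ->; exists (triple nu gam) => //; apply: imset_f.
Qed.

End PartitionTermPerm.

(** * From set partitions to the explicit formula *)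

Theorem theorem5p20 (R : realType) (K : numFieldType)
    (hK : K = R :> numFieldType \/ K = R[i]%C :> numFieldType)
    (n m : nat) (hn : (1 <= n)%N) (hm : (1 <= m)%N)
    (g : 'I_m -> 'rV[K]_n -> K) (f : 'rV[K]_m -> K)
    (hg : forall j, smooth (g j)) (hf : smooth f)
    (k : nat) (i : 'I_k.+1 -> 'I_n)
    (F : forall d : nat,
       {ffun 'I_d -> 'I_k.+2} -> {ffun 'I_d -> 'I_k.+2} -> {set 'S_k.+1})
    (hF : forall (d : nat) (lam mu : {ffun 'I_d -> 'I_k.+2}),
       lam_ok lam -> mu_ok lam mu -> is_coset_repr lam mu (F d lam mu)) :
  let G (x : 'rV[K]_n) : 'rV[K]_m := \row_(j < m) g j x in
  let h (x : 'rV[K]_n) : K := f (G x) in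
  let idx : seq 'I_n := [seq i a | a : 'I_k.+1] in
  has_partials idx h /\
  forall x : 'rV[K]_n,
    partials idx h x =
    \sum_(1 <= d < k.+2)
    \sum_(lam : {ffun 'I_d -> 'I_k.+2} | lam_ok lam)
    \sum_(mu : {ffun 'I_d -> 'I_k.+2} | mu_ok lam mu)
    \sum_(l : {ffun {e : 'I_d & 'I_(mu e)} -> 'I_m})
      partials [seq l (Tagged _ nu) | e <- enum 'I_d, nu <- enum 'I_(mu e)]
        f (G x) *
      (\sum_(s in F d lam mu)
       \prod_(e < d) \prod_(nu < mu e)
         partials [seq i (s (triple nu gamma)) | gamma : 'I_(lam e)]
           (g (l (Tagged _ nu))) x).
Proof.
move=> G h idx.
have mvb : mean_value_bound K.
  by case: hK => ->; [exact: mean_value_bound_real | exact: mean_value_bound_complex].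
have [h1 h2] := partials_comp_partition mvb hg hf i (enum_uniq 'I_k.+1).
split=> // x.
rewrite [LHS]h2 set_enumT big_partition_type.
apply: eq_bigr => d _; apply: eq_bigr => lam lamP; apply: eq_bigr => mu muP.
rewrite -(big_coset_repr lamP muP _ _ (hF _ _ _ lamP muP)).
under eq_bigr => s _ do rewrite (partition_term_perm _ _ _ mvb hg hf lamP muP).
(* The derivative of [f] depends on [l] but not on [s], so it factors out of the sum over
   representatives. *)
rewrite exchange_big /=; apply: eq_bigr => l _.
by rewrite big_distrr.
Qed.
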